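(* Let $n\ge 1$ be an integer, let $\kappa\in\mathbb{R}$, let $I\subset(0,\infty)$ be an open interval, and let $g(\mathbf{x})=g(r)$ be a smooth real function of the radial coordinate $r=|\mathbf{x}|$ alone, defined on $\{\mathbf{x}\in\mathbb{R}^n : |\mathbf{x}|\in I\}$. Put $f=g'$ (prime denoting $d/dr$) and suppose that $f$ and $f'$ have no zeros on $I$. Then $g$ satisfies Abreu's equation $$\sum_{j,k=1}^n \partial_j\partial_k g^{jk}=-\kappa$$ on $\{\mathbf{x}\in\mathbb{R}^n : |\mathbf{x}|\in I\}$ if and only if there is a constant $\lambda\in\mathbb{R}$ such that $$f''=\left(\frac{\kappa}{n}\,r-\frac{\lambda}{r^{n-1}}-\frac{n-1}{f}\right)(f')^2+\frac{n-1}{r}\,f'\qquad\text{for all } r\in I .$$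
   Context: For a function $g$ on an open subset of $\mathbb{R}^n$ with coordinates $\mathbf{x}=(x_1,\dots,x_n)^T$ and $\partial_j=\partial/\partial x_j$, the Hessian matrix is $\mathbf{G}=(g_{jk})$ with $g_{jk}=\partial_j\partial_k g$, and $g^{jk}$ denotes the entries of the inverse matrix $\mathbf{G}^{-1}=(g^{jk})$ (assumed to exist). For $g=g(r)$ the Hessian is $\mathbf{G}=\frac{f}{r}\mathbf{1}+\frac1r\left(\frac fr\right)'\mathbf{x}\mathbf{x}^T$. *)

(* Defs.v *)
From HB Require Import structures.
From mathcomp Require Import all_boot all_order all_algebra.
From mathcomp Require Import all_classical all_reals all_analysis.

Set Implicit Arguments.
Unset Strict Implicit.
Unset Printing Implicit Defensive.

Import Order.TTheory GRing.Theory Num.Theory.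
Import numFieldNormedType.Exports.
Local Open Scope ring_scope.
Local Open Scope classical_set_scope.

(* The library norm `|x| on matrices is the sup norm, hence a separate
   Euclidean norm.  The two norms induce the same topology, so limits and
   directional derivatives are the usual ones. *)
Definition enorm (R : realType) (n : nat) (x : 'cV[R]_n) : R :=
  Num.sqrt (\sum_(i < n) x i 0 ^+ 2).

Definition shell (R : realType) (n : nat) (I : set R) : set 'cV[R]_n :=
  [set x | I (enorm x)].

Definition partial (R : realType) (n : nat) (j : 'I_n) (g : 'cV[R]_n -> R) :
    'cV[R]_n -> R :=
  fun x => 'D_(delta_mx j 0) g x.

Definition hessian (R : realType) (n : nat) (g : 'cV[R]_n -> R)
    (x : 'cV[R]_n) : 'M[R]_n :=
  \matrix_(j, k) partial j (partial k g) x.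

Definition inv_hessian (R : realType) (n : nat) (g : 'cV[R]_n -> R)
    (j k : 'I_n) : 'cV[R]_n -> R :=
  fun x => invmx (hessian g x) j k.

(* invmx A = A when A is singular, so the existence of the inverse
   Hessian is made part of being a solution. *)
Definition abreu_on (R : realType) (n : nat) (U : set 'cV[R]_n)
    (g : 'cV[R]_n -> R) (kappa : R) : Prop :=
  forall x, U x ->
    hessian g x \in unitmx /\
    \sum_(j < n) \sum_(k < n) partial j (partial k (inv_hessian g j k)) x
      = - kappa.

(* Meant for open I. *)
Definition smooth_on (R : realType) (I : set R) (phi : R -> R) : Prop :=
  forall (m : nat) (r : R), I r -> derivable (phi^`(m)) r 1.

(* Main.v *)
Require Import Defs.
From HB Require Import structures.
From mathcomp Require Import all_boot all_order all_algebra.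
From mathcomp Require Import ring.
From mathcomp Require Import all_classical all_reals all_analysis.

Set Implicit Arguments.
Unset Strict Implicit.
Unset Printing Implicit Defensive.

Import Order.TTheory GRing.Theory Num.Theory.
Import numFieldNormedType.Exports.
Local Open Scope ring_scope.
Local Open Scope classical_set_scope.

(** Write r for the Euclidean norm of x.  The Hessian of g is
    h(r) 1 + c(r) x x^T with h = f/r and c = h'/r: it acts as f/r on the
    hyperplane orthogonal to x and as f' on the line spanned by x.  Neither
    factor vanishes, so the inverse is again of the form a(r) 1 + b(r) x x^T,
    where a = r/f and a + r^2 b = 1/f' ([inv_hessian_radial]).

    The inner divergence of such a tensor is the radial field W(r) x with
    W = a'/r + r b' + (n + 1) b, and the divergence of W(r) x is r W' + n W
    ([double_divergence_radial], [abreu_radial]).  Hence Abreu's equation is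
    the linear first-order equation r W' + n W = - kappa, that is
    (r^n (W + kappa/n))' = 0.  On an interval this says
    W = lambda / r^n - kappa/n for a constant lambda ([euler_ode]).  Since
    W = (n - 1)/(r^2 f') - f''/(r f'^2) - (n - 1)/(r f), solving for f'' gives
    the stated equation ([flux_odeP]).  Spheres of all radii in I are nonempty
    when n >= 1 ([ex_shell]), so no radius escapes the equation on the shell.

    The library derivative of a function without a derivative is an arbitrary
    value, and partial derivatives are additive only where they exist.  So
    every step proves [is_derive], entry by entry of the tensors, rather than
    manipulating the values of the derivatives. *)

(** * Differentiation rules and reduction to lines *)

(** The rules below restate those of the library for explicit abstractions
    instead of operations in the ring of functions, and with products instead
    of scalings, so that proof terms assembled from them have derivatives that
    ring and field can read. *)
Section pointwise_rules.
Context {R : realType} {V : normedModType R}.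
Implicit Types (u w : V -> R) (x v : V) (a b c : R).

Lemma is_derive_pD u w x v a b : is_derive x v u a -> is_derive x v w b ->
  is_derive x v (fun y => u y + w y) (a + b).
Proof. by move=> ua wb; exact: (@is_deriveD _ _ _ u w). Qed.

Lemma is_derive_pB u w x v a b : is_derive x v u a -> is_derive x v w b ->
  is_derive x v (fun y => u y - w y) (a - b).
Proof. by move=> ua wb; exact: (@is_deriveB _ _ _ u w). Qed.

Lemma is_derive_pM u w x v a b : is_derive x v u a -> is_derive x v w b ->
  is_derive x v (fun y => u y * w y) (u x * b + w x * a).
Proof. by move=> ua wb; exact: (@is_deriveM _ _ u w). Qed.

Lemma is_derive_pX u n x v a : is_derive x v u a ->
  is_derive x v (fun y => u y ^+ n) (n%:R * u x ^+ n.-1 * a).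
Proof.
move=> ua; have -> : (fun y => u y ^+ n) = u ^+ n.
  by apply/funext => y; rewrite fctE.
exact: is_deriveX.
Qed.

Lemma is_derive_pS m (u : 'I_m -> V -> R) x v (a : 'I_m -> R) :
  (forall i, is_derive x v (u i) (a i)) ->
  is_derive x v (fun y => \sum_i u i y) (\sum_i a i).
Proof.
have -> : (fun y => \sum_i u i y) = \sum_i u i.
  by apply/funext => y; rewrite fct_sumE.
exact: is_derive_sum.
Qed.

Lemma is_derive_pC c x v : is_derive x v (fun=> c) 0.
Proof. exact: is_derive_cst. Qed.

(** Both sides are the limit of the same difference quotient.  This transfers
    the one-variable chain rule and locality arguments to directional
    derivatives without any use of the topology of the matrix space. *)
Lemma is_derive_lineP u x v a :
  is_derive (0 : R) 1 (fun t : R => u (t *: v + x)) a <-> is_derive x v u a.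
Proof.
have E : (fun h : R => h^-1 *: (((fun t : R => u (t *: v + x)) \o shift 0)
             (h *: 1) - u (0 *: v + x))) =
         (fun h : R => h^-1 *: ((u \o shift x) (h *: v) - u x)).
  by apply/funext => h /=; rewrite addr0 scale0r add0r [h *: 1]mulr1.
by split=> -[d e]; split; move: d e; rewrite /derivable /derive /= E.
Qed.

Lemma is_derive_comp1 (F : R -> R) u x v a b :
  is_derive (u x) 1 F a -> is_derive x v u b ->
  is_derive x v (fun y => F (u y)) (a * b).
Proof.
move=> Fa /is_derive_lineP ub; apply/is_derive_lineP.
by apply: (@is_derive1_comp _ F) => //; rewrite scale0r add0r.
Qed.

End pointwise_rules.

(** * Radial functions on a shell *)

Section euclidean_norm.
Context {R : realType} {n : nat}.
Implicit Types (x : 'cV[R]_n) (i j k : 'I_n).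

Lemma enorm_sqr x : enorm x ^+ 2 = \sum_i x i 0 ^+ 2.
Proof. by rewrite sqr_sqrtr// sumr_ge0// => i _; exact: sqr_ge0. Qed.

Lemma is_derive_coord j k x :
  is_derive x (delta_mx j 0) (fun y => y k 0) (j == k)%:R.
Proof.
apply/is_derive_lineP; apply: is_derive_eq.
  have -> : (fun t : R => (t *: delta_mx j 0 + x) k 0) =
            (fun t : R => t * (j == k)%:R + x k 0).
    by apply/funext => t; rewrite !mxE eqxx andbT eq_sym.
  exact: is_derive_pD.
by rewrite scaler0 addr0 add0r [LHS]mulr1.
Qed.

Lemma is_derive_enorm j x : 0 < enorm x ->
  is_derive x (delta_mx j 0) (@enorm R n) (x j 0 / enorm x).
Proof.
move=> x0; 
change (is_derive x (delta_mx j 0)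
  (fun y : 'cV[R]_n => Num.sqrt (\sum_i y i 0 ^+ 2)) (x j 0 / enorm x)).
apply: is_derive_eq.
  apply: (@is_derive_comp1 _ _ Num.sqrt (fun y : 'cV[R]_n => \sum_i y i 0 ^+ 2)).
    by apply: is_derive1_sqrt; rewrite -enorm_sqr exprn_gt0.
  by apply: is_derive_pS => i; apply: is_derive_pX; exact: is_derive_coord.
rewrite -/(enorm x) (bigD1 j)//= big1 ?addr0; last first.
  by move=> i /negPf ij; rewrite eq_sym ij mulr0.
by rewrite eqxx expr1 mulr1; field; rewrite gt_eqF.
Qed.

(** Derivatives of radial profiles are factored as r times d, because d is then
    the profile of a new radial function multiplying a coordinate. *)
Lemma is_derive_radial (F : R -> R) (d : R) j x : 0 < enorm x ->
  is_derive (enorm x) 1 F (enorm x * d) ->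
  is_derive x (delta_mx j 0) (fun y => F (enorm y)) (d * x j 0).
Proof.
move=> x0 Fd; apply: is_derive_eq.
  exact: (is_derive_comp1 Fd (is_derive_enorm j x0)).
by field; rewrite gt_eqF.
Qed.

(** The norm is differentiable, hence continuous, along the line, and I is
    open. *)
Lemma near_shell (I : set R) j x : open I -> I `<=` [set r | 0 < r] ->
  shell I x -> \forall t \near (0 : R), shell I (t *: delta_mx j 0 + x).
Proof.
move=> Io Ip Ix; have /is_derive_lineP[d _] := is_derive_enorm j (Ip _ Ix).
move/derivable1_diffP/differentiable_continuous: d; apply.
by rewrite scale0r add0r; exact: open_nbhs_nbhs.
Qed.

(** Partial derivatives are local, so a closed form valid on the shell only may
    be differentiated again.  This is what allows second derivatives to be
    computed by successive closed forms. *)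
Lemma partial_shell (I : set R) j x (G H : 'cV[R]_n -> R) (d : R) :
  open I -> I `<=` [set r | 0 < r] -> shell I x ->
  (forall y, shell I y -> G y = H y) ->
  is_derive x (delta_mx j 0) H d -> partial j G x = d.
Proof.
move=> Io Ip Ix GH /is_derive_lineP Hd.
suff /is_derive_lineP[_ <-] : is_derive (0 : R) 1
  (fun t : R => G (t *: delta_mx j 0 + x)) d by [].
apply: near_eq_is_derive Hd; near do apply/esym/GH.
by exact: near_shell.
Unshelve. all: by end_near. Qed.

(** A multiple of the first basis vector. *)
Lemma ex_shell (I : set R) (r : R) : (0 < n)%N -> I `<=` [set r | 0 < r] -> I r ->
  exists x : 'cV[R]_n, enorm x = r.
Proof.
case: n => // m _ Ip Ir; exists (r *: delta_mx 0 0).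
rewrite /enorm (bigD1 0)//= big1 ?addr0; last first.
  by move=> i /negPf i0; rewrite !mxE i0 mulr0 expr0n.
by rewrite !mxE mulr1 sqrtr_sqr gtr0_norm //; exact: Ip.
Qed.

End euclidean_norm.

(** * Tensors of the form a(r) 1 + b(r) x x^T *)

Section radial_tensor.
Context {R : realType} {n : nat}.
Implicit Types (a b : R -> R) (x : 'cV[R]_n) (i j k : 'I_n).

Definition radial_tensor a b j k x : R :=
  (j == k)%:R * a (enorm x) + b (enorm x) * (x j 0 * x k 0).

Lemma is_derive_radial_tensor a b (A B : R) i j k x : 0 < enorm x ->
  is_derive (enorm x) 1 a (enorm x * A) ->
  is_derive (enorm x) 1 b (enorm x * B) ->
  is_derive x (delta_mx i 0) (radial_tensor a b j k)
    ((j == k)%:R * (A * x i 0) + B * (x i 0 * x j 0 * x k 0)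
      + b (enorm x) * ((i == j)%:R * x k 0 + (i == k)%:R * x j 0)).
Proof.
move=> x0 aA bB; rewrite /radial_tensor.
have da := is_derive_radial i x0 aA.
have db := is_derive_radial i x0 bB.
have cj := is_derive_coord i j x.
have ck := is_derive_coord i k x.
apply: (is_derive_eq (is_derive_pD (is_derive_pM (is_derive_pC _ _ _) da)
  (is_derive_pM db (is_derive_pM cj ck)))).
by rewrite /=; ring.
Qed.

(** With A = a'/r and B = b'/r, the inner divergence is W(r) x for
    W = A + r^2 B + (n + 1) b, and the right-hand side is r W' + n W expanded.
    The sum is computed from its entries: since T is only known on the shell,
    each second partial derivative is obtained by applying [partial_shell]
    twice. *)
Lemma double_divergence_radial (I : set R) a b (A B dA dB : R -> R)
    (T : 'I_n -> 'I_n -> 'cV[R]_n -> R) x :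
  open I -> I `<=` [set r | 0 < r] ->
  (forall r, I r -> is_derive r 1 a (r * A r)) ->
  (forall r, I r -> is_derive r 1 b (r * B r)) ->
  (forall r, I r -> is_derive r 1 A (dA r)) ->
  (forall r, I r -> is_derive r 1 B (dB r)) ->
  (forall j k y, shell I y -> T j k y = radial_tensor a b j k y) ->
  shell I x ->
  \sum_j \sum_k partial j (partial k (T j k)) x =
    let r := enorm x in
    r * dA r + n%:R * A r + r ^+ 3 * dB r + (2 * n%:R + 3) * r ^+ 2 * B r
      + n%:R * (n%:R + 1) * b r.
Proof.
move=> Io Ip aA bB dAA dBB TE Ix /=.
have x0 : 0 < enorm x by exact: Ip.
set r := enorm x; have r0 : r != 0 by exact: lt0r_neq0.
have E1 j k y : shell I y -> partial k (T j k) y =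
    (j == k)%:R * (A (enorm y) * y k 0) + B (enorm y) * (y k 0 * y j 0 * y k 0)
      + b (enorm y) * ((k == j)%:R * y k 0 + y j 0).
  move=> Iy; apply: (partial_shell Io Ip Iy (TE j k)).
  apply: (is_derive_eq
    (is_derive_radial_tensor k j k (Ip _ Iy) (aA _ Iy) (bB _ Iy))).
  by rewrite eqxx mul1r; ring.
have E2 j k : partial j (partial k (T j k)) x =
    (j == k)%:R * (A r + b r + x j 0 ^+ 2 * (dA r / r + 3 * B r))
    + (dB r / r * (x j 0 ^+ 2) * x k 0 ^+ 2 + B r * x k 0 ^+ 2
       + (B r * x j 0 ^+ 2 + b r)).
  apply: (partial_shell Io Ip Ix (E1 j k)).
  have rd (F : R -> R) (d : R) : is_derive r 1 F d ->
      is_derive x (delta_mx j 0) (fun y => F (enorm y)) (d / r * x j 0).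
    by move=> Fd; apply: is_derive_radial => //; rewrite mulrC divfK ?gt_eqF.
  have dA' := rd _ _ (dAA _ Ix).
  have dB' := rd _ _ (dBB _ Ix).
  have db' := rd _ _ (bB _ Ix).
  have cj := is_derive_coord j j x.
  have ck := is_derive_coord j k x.
  apply: (is_derive_eq (is_derive_pD (is_derive_pD
      (is_derive_pM (is_derive_pC _ _ _) (is_derive_pM dA' ck))
      (is_derive_pM dB' (is_derive_pM (is_derive_pM ck cj) ck)))
      (is_derive_pM db' (is_derive_pD (is_derive_pM (is_derive_pC _ _ _) ck) cj)))).
  rewrite -/r eqxx [k == j]eq_sym; rewrite mulr1n.
  by have [<-|_] := eqVneq j k; rewrite ?mulr1n ?mulr0n; field.
have S : \sum_i x i 0 ^+ 2 = r ^+ 2 by rewrite -enorm_sqr.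
transitivity (\sum_j (A r + b r + n%:R * b r + B r * r ^+ 2
    + x j 0 ^+ 2 * (dA r / r + 3 * B r + dB r / r * r ^+ 2 + n%:R * B r))).
  apply: eq_bigr => j _; under eq_bigr do rewrite E2.
  rewrite big_split/= (bigD1 j)//= big1 ?addr0; last first.
    by move=> k kj; rewrite eq_sym (negPf kj) mul0r.
  rewrite big_split/= big_split/= -!mulr_sumr S sumr_const card_ord -mulr_natl.
  by rewrite eqxx mul1r; ring.
rewrite big_split/= -mulr_suml S sumr_const card_ord -mulr_natl.
by field.
Qed.

(** A tensor a 1 + b x x^T has eigenvalue a orthogonally to x and a + r^2 b
    along x; the two equations say that these are inverse to those of the other
    tensor. *)
Lemma radial_tensor_inv a b a' b' x : 0 < enorm x ->
  a (enorm x) * a' (enorm x) = 1 ->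
  (a (enorm x) + enorm x ^+ 2 * b (enorm x)) *
    (a' (enorm x) + enorm x ^+ 2 * b' (enorm x)) = 1 ->
  (\matrix_(j, k) radial_tensor a b j k x) *m
    (\matrix_(j, k) radial_tensor a' b' j k x) = 1%:M.
Proof.
set r := enorm x => r0 aa' bb'.
have tE (c d : R -> R) : \matrix_(j, k) radial_tensor c d j k x =
    (c r)%:M + d r *: (x *m x^T).
  apply/matrixP => j k; rewrite !mxE big_ord1 !mxE /radial_tensor -/r.
  by rewrite mulr_natl.
rewrite !tE mulmxDl !mulmxDr -scalar_mxM aa' -addrA -[RHS]addr0; congr (_ + _).
have xx : x *m x^T *m (x *m x^T) = r ^+ 2 *: (x *m x^T).
  rewrite mulmxA -[x *m _ *m x]mulmxA [x^T *m x]mx11_scalar mul_mx_scalar scalemxAl.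
  congr (_ *: x *m _); rewrite !mxE enorm_sqr; apply: eq_bigr => i _.
  by rewrite !mxE expr2.
rewrite mul_scalar_mx -!scalemxAl -!scalemxAr mul_mx_scalar xx !scalerA -!scalerDl.
suff -> : a r * b' r + (b r * a' r + b r * b' r * r ^+ 2) = 0 by rewrite scale0r.
(* After multiplication by r^2 the coefficient of x x^T is the difference of
   the products of the radial and of the tangential eigenvalues, 1 - 1. *)
apply: (@mulfI _ (r ^+ 2)); first by rewrite expf_neq0// gt_eqF.
rewrite mulr0 -[RHS](subrr 1) -[in X in _ = X - _]bb' -aa'; ring.
Qed.

End radial_tensor.

(** * The first integral of r W' + n W = - kappa *)

Section first_integral.
Context {R : realType}.

Lemma is_derive0_cst_on (I : set R) (K : R -> R) (r s : R) : is_interval I ->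
  (forall t, I t -> is_derive t 1 K 0) -> I r -> I s -> K r = K s.
Proof.
move=> Ii K0; wlog rs : r s / r <= s => [wl Ir Is|Ir Is].
  by have [/wl|/ltW/wl H] := leP r s; [exact|exact/esym/H].
have Irs t : t \in `[r, s]%R -> I t.
  by rewrite in_itv => /= rts; exact: (Ii r s).
have [||c _] := @MVT_segment _ K (fun=> 0) r s rs.
- by move=> t /subset_itv_oo_cc/Irs; exact: K0.
- by apply: derivable_within_continuous => t /Irs/K0[].
by rewrite mul0r => /eqP; rewrite subr_eq0 => /eqP.
Qed.

(** r^(n-1) is an integrating factor: K = r^n (W + kappa/n) has derivative
    r^(n-1) (r W' + n W + kappa), so the equation holds on I exactly when K is
    constant there, and lambda is the value of K. *)
Lemma euler_ode (I : set R) (W dW : R -> R) (n : nat) (kappa : R) :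
  (0 < n)%N -> open I -> is_interval I -> I `<=` [set r | 0 < r] ->
  (forall r, I r -> is_derive r 1 W (dW r)) ->
  (forall r, I r -> r * dW r + n%:R * W r = - kappa) <->
  exists lambda, forall r, I r -> W r = lambda / r ^+ n - kappa / n%:R.
Proof.
move=> n0 Io Ii Ip WdW; have nR0 : n%:R != 0 :> R by rewrite pnatr_eq0 -lt0n.
pose K r := r ^+ n * (W r + kappa / n%:R).
have dK r : I r ->
    is_derive r 1 K (r ^+ n.-1 * (r * dW r + n%:R * W r + kappa)).
  move=> Ir; apply: (is_derive_eq (is_derive_pM
    (is_derive_pX n (is_derive_id r (1 : R)))
    (is_derive_pD (WdW _ Ir) (is_derive_pC _ _ _)))).
  by rewrite /= -{1}(prednK n0) exprS; field.
have KE r l : I r -> K r = l <-> W r = l / r ^+ n - kappa / n%:R.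
  move=> /Ip r0; have rn0 : r ^+ n != 0 by rewrite expf_neq0// gt_eqF.
  rewrite /K; split => [<-|->]; last by field; rewrite nR0.
  by rewrite mulrAC divff// mul1r addrK.
split => [WE|[l WE] r Ir].
(* An empty I has no point at which to read off lambda; any value will do. *)
- have [[s Is]|nI] := pselect (exists s, I s); last first.
    by exists 0 => r Ir; case: nI; exists r.
  exists (K s) => r Ir; apply/KE => //.
  apply: (is_derive0_cst_on Ii) => // t It; apply: (is_derive_eq (dK t It)).
  by rewrite WE// addNr mulr0.
- have [_ dK0] : is_derive r 1 K 0.
    apply: near_eq_is_derive (is_derive_pC l r 1); near=> t.
    have It : I t by near: t; exact: open_nbhs_nbhs.
    by apply/esym/KE => //; exact: WE.
  have [_ /esym/eqP] := dK r Ir.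
  rewrite dK0 mulf_eq0 expf_eq0 gt_eqF ?andbF ?Ip//=.
  by rewrite addr_eq0 => /eqP.
Unshelve. all: by end_near. Qed.

End first_integral.

(** * The profiles of the Hessian and of its inverse *)

Section inverse_profiles.
Context {R : realType}.
Implicit Types (f : R -> R) (r : R).

(** [hess_tan] and [hess_rad] are the profiles h and c of the Hessian
    h 1 + c x x^T, [inv_tan] and [inv_rad] those, a and b, of its inverse.
    [hess_rad], [inv_tan_slope] and [inv_rad_slope] are h'/r, a'/r and b'/r
    written out; that these are explicit in f, f' and f'' makes them
    differentiable in turn. *)
Definition hess_tan f r : R := f r / r.

Definition hess_rad f r : R := (f^`()%classic r / r - f r / r ^+ 2) / r.

Definition inv_tan f r : R := r * (f r)^-1.

Definition inv_rad f r : R :=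
  r^-1 ^+ 2 * (f^`()%classic r)^-1 - r^-1 * (f r)^-1.

Definition inv_tan_slope f r : R :=
  r^-1 * (f r)^-1 - f^`()%classic r * (f r)^-1 ^+ 2.

Definition inv_rad_slope f r : R :=
  r^-1 ^+ 3 * (f r)^-1 + r^-1 ^+ 2 * (f^`()%classic r * (f r)^-1 ^+ 2)
  - (2 * (r^-1 ^+ 4 * (f^`()%classic r)^-1)
     + r^-1 ^+ 3 * (f^`(2)%classic r * (f^`()%classic r)^-1 ^+ 2)).

(** The factor W of the radial field W(r) x that is the divergence of
    a(r) 1 + b(r) x x^T. *)
Definition flux (n : nat) f r : R :=
  inv_tan_slope f r + r ^+ 2 * inv_rad_slope f r + (n%:R + 1) * inv_rad f r.

(** The last term merges 2 r B from the derivative of r^2 B, for B = b'/r, with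
    (n + 1) b' = (n + 1) r B. *)
Definition dflux (n : nat) f r : R :=
  (inv_tan_slope f)^`()%classic r + r ^+ 2 * (inv_rad_slope f)^`()%classic r
  + (n%:R + 3) * r * inv_rad_slope f r.

Lemma is_derive_inv_profiles f r : r != 0 -> f r != 0 -> f^`()%classic r != 0 ->
  derivable f r 1 -> derivable f^`() r 1 -> derivable f^`(2)%classic r 1 ->
  [/\ is_derive r 1 (hess_tan f) (r * hess_rad f r),
      is_derive r 1 (inv_tan f) (r * inv_tan_slope f r),
      is_derive r 1 (inv_rad f) (r * inv_rad_slope f r),
      is_derive r 1 (inv_tan_slope f) ((inv_tan_slope f)^`()%classic r) &
      is_derive r 1 (inv_rad_slope f) ((inv_rad_slope f)^`()%classic r)].
Proof.
move=> r0 fr0 f'r0 df df' df''.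
have D (F : R -> R) : derivable F r 1 -> is_derive r 1 F (F^`()%classic r).
  by move=> dF; rewrite derive1E; exact: derivableP.
have V (F : R -> R) (d : R) : F r != 0 -> is_derive r 1 F d ->
    is_derive r 1 (fun y => (F y)^-1) (- (F r) ^- 2 * d).
  exact: is_deriveV.
have dr := is_derive_id r (1 : R); have dri := V _ _ r0 dr.
have d0 := D _ df; have di0 := V _ _ fr0 d0.
have d1 := D _ df'; have di1 := V _ _ f'r0 d1.
have d2 := D _ df''.
have f2E : f^`()^`()%classic r = f^`(2)%classic r by [].
split.
- apply: (is_derive_eq (is_derive_pM d0 dri)).
  by rewrite /hess_rad /=; field.
- apply: (is_derive_eq (is_derive_pM dr di0)).
  by rewrite /inv_tan_slope /= mulr1; field; rewrite fr0.
- rewrite /inv_rad.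
  apply: (is_derive_eq (is_derive_pB (is_derive_pM (is_derive_pX 2 dri) di1)
    (is_derive_pM dri di0))).
  by rewrite /inv_rad_slope f2E /=; field; rewrite f'r0 r0 fr0.
- apply: (D (inv_tan_slope f)).
  apply: (@ex_derive _ _ _ _ _ _ _ (is_derive_pB (is_derive_pM dri di0)
    (is_derive_pM d1 (is_derive_pX 2 di0)))).
- apply: (D (inv_rad_slope f)).
  apply: (@ex_derive _ _ _ _ _ _ _ (is_derive_pB
    (is_derive_pD (is_derive_pM (is_derive_pX 3 dri) di0)
       (is_derive_pM (is_derive_pX 2 dri) (is_derive_pM d1 (is_derive_pX 2 di0))))
    (is_derive_pD
       (is_derive_pM (is_derive_pC _ _ _) (is_derive_pM (is_derive_pX 4 dri) di1))
       (is_derive_pM (is_derive_pX 3 dri) (is_derive_pM d2 (is_derive_pX 2 di1)))))).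
Qed.

(** The two equations are proportional: the difference of the sides of the
    first is that of the second divided by - r f'^2. *)
Lemma flux_odeP (n : nat) f (kappa lambda r : R) : (0 < n)%N ->
  r != 0 -> f r != 0 -> f^`()%classic r != 0 ->
  flux n f r = lambda / r ^+ n - kappa / n%:R <->
  f^`(2)%classic r =
      (kappa / n%:R * r - lambda / r ^+ (n - 1) - (n%:R - 1) / f r)
        * f^`()%classic r ^+ 2
      + (n%:R - 1) / r * f^`()%classic r.
Proof.
case: n => // n _ r0 fr0 f'r0; have rn0 : r ^+ n != 0 by rewrite expf_neq0.
rewrite subSS subn0 exprS /flux /inv_tan_slope /inv_rad_slope /inv_rad.
have : n.+1%:R != 0 :> R by rewrite pnatr_eq0.
move: (n.+1%:R) (f r) (f^`()%classic r) (f^`(2)%classic r) (r ^+ n) fr0 f'r0 rn0.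
move=> N F F1 F2 P F0 F10 P0 N0.
set ode := (RHS in _ <-> _ = RHS).
set lhs := (X in X = _ <-> _); set rhs := (X in _ = X <-> _).
have E : lhs - rhs = - (F2 - ode) / (r * F1 ^+ 2).
  by rewrite /lhs /rhs /ode; field; rewrite N0 r0 F0 F10 P0.
have d0 : r * F1 ^+ 2 != 0 by rewrite mulf_neq0// expf_neq0.
split => /eqP; rewrite -subr_eq0.
  by rewrite E mulf_eq0 invr_eq0 (negPf d0) orbF oppr_eq0 subr_eq0 => /eqP.
by move=> /eqP e; apply/eqP; rewrite -subr_eq0 E e oppr0 mul0r.
Qed.

End inverse_profiles.

(** * Abreu's operator on radial functions *)

Section radial_hessian.
Context {R : realType} {n : nat}.
Context (I : set R) (phi : R -> R) (g : 'cV[R]_n -> R).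
Context (I_open : open I) (I_pos : I `<=` [set r | 0 < r]).
Context (phi_smooth : smooth_on I phi).
Context (g_radial : forall x, shell I x -> g x = phi (enorm x)).
Let f := phi^`()%classic.
Context (f_neq0 : forall r, I r -> f r != 0).
Context (f'_neq0 : forall r, I r -> f^`()%classic r != 0).

Let profiles r (Ir : I r) := is_derive_inv_profiles (lt0r_neq0 (I_pos Ir))
  (f_neq0 Ir) (f'_neq0 Ir)
  (@phi_smooth 1 r Ir) (@phi_smooth 2 r Ir) (@phi_smooth 3 r Ir).

Lemma hessian_radial x : shell I x ->
  hessian g x = \matrix_(j, k) radial_tensor (hess_tan f) (hess_rad f) j k x.
Proof.
move=> Ix; apply/matrixP => j k; rewrite !mxE.
have dg y : shell I y -> partial k g y = hess_tan f (enorm y) * y k 0.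
  move=> Iy; apply: (partial_shell I_open I_pos Iy g_radial).
  apply: is_derive_radial; first exact: I_pos.
  rewrite mulrC divfK ?lt0r_neq0//; last exact: I_pos.
  by rewrite /f derive1E; apply: derivableP; exact: (@phi_smooth 0).
have [dh _ _ _ _] := profiles Ix.
apply: (partial_shell I_open I_pos Ix dg).
apply: (is_derive_eq (is_derive_pM (is_derive_radial j (I_pos Ix) dh)
  (is_derive_coord j k x))).
by rewrite /radial_tensor; ring.
Qed.

Lemma inv_hessian_radial x : shell I x -> hessian g x \in unitmx /\
  forall j k, inv_hessian g j k x = radial_tensor (inv_tan f) (inv_rad f) j k x.
Proof.
move=> Ix; have r0 := I_pos Ix; have rn0 := lt0r_neq0 r0.
have f0 := f_neq0 Ix; have f'0 := f'_neq0 Ix.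
set B := \matrix_(j, k) radial_tensor (inv_tan f) (inv_rad f) j k x.
have HB : hessian g x *m B = 1%:M.
  rewrite hessian_radial//; apply: radial_tensor_inv => //.
    by rewrite /hess_tan /inv_tan; field; rewrite f0 rn0.
  by rewrite /hess_tan /hess_rad /inv_tan /inv_rad; field; rewrite rn0 f0.
have [uH _] := mulmx1_unit HB; split => // j k.
by rewrite /inv_hessian -[invmx _]mulmx1 -HB mulKmx// mxE.
Qed.

Lemma is_derive_flux r : I r ->
  is_derive r 1 (flux n f) (dflux n f r).
Proof.
move=> Ir; have [_ _ db dA dB] := profiles Ir; rewrite /flux.
apply: (is_derive_eq (is_derive_pD (is_derive_pD dA
  (is_derive_pM (is_derive_pX 2 (is_derive_id r (1 : R))) dB))
  (is_derive_pM (is_derive_pC _ _ _) db))).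
by rewrite /dflux /= mulr1; ring.
Qed.

Lemma abreu_radial x : shell I x ->
  \sum_(j < n) \sum_(k < n) partial j (partial k (inv_hessian g j k)) x =
  enorm x * dflux n f (enorm x) + n%:R * flux n f (enorm x).
Proof.
move=> Ix.
rewrite (double_divergence_radial I_open I_pos
  (fun r Ir => let: And5 _ d _ _ _ := profiles Ir in d)
  (fun r Ir => let: And5 _ _ d _ _ := profiles Ir in d)
  (fun r Ir => let: And5 _ _ _ d _ := profiles Ir in d)
  (fun r Ir => let: And5 _ _ _ _ d := profiles Ir in d)
  (fun j k y Iy => (inv_hessian_radial Iy).2 j k) Ix) /=.
by rewrite /dflux /flux; ring.
Qed.

End radial_hessian.

(** * The reduction of Abreu's equation *)

Theorem mainTheorem1 (R : realType) (n : nat) (hn : (1 <= n)%N) (kappa : R)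
    (I : set R) (I_open : open I) (I_itv : is_interval I)
    (I_pos : I `<=` [set r | 0 < r])
    (phi : R -> R) (phi_smooth : smooth_on I phi)
    (g : 'cV[R]_n -> R) (g_radial : forall x, shell I x -> g x = phi (enorm x))
    (f : R -> R) (f_def : f = phi^`())
    (f_neq0 : forall r, I r -> f r != 0)
    (f'_neq0 : forall r, I r -> f^`() r != 0) :
  abreu_on (shell I) g kappa <->
  exists lambda : R, forall r : R, I r ->
    f^`(2) r =
      (kappa / n%:R * r - lambda / r ^+ (n - 1) - (n%:R - 1) / f r)
        * f^`()%classic r ^+ 2
      + (n%:R - 1) / r * f^`()%classic r.
Proof.
subst f; set f := phi^`()%classic.
have dW r (Ir : I r) : is_derive r 1 (flux n f) (dflux n f r).
  by apply: is_derive_flux Ir.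
have odeP := euler_ode kappa hn I_open I_itv I_pos dW.
have odeE lambda r (Ir : I r) := flux_odeP kappa lambda hn
  (lt0r_neq0 (I_pos _ Ir)) (f_neq0 _ Ir) (f'_neq0 _ Ir).
transitivity (forall r, I r ->
    r * dflux n f r + n%:R * flux n f r = - kappa).
  split=> [abreu r Ir|WE x Ix].
    have [x xr] := ex_shell hn I_pos Ir; rewrite -xr in Ir *.
    by rewrite -(abreu_radial I_open I_pos phi_smooth g_radial)//; case: (abreu x Ir).
  split; last by rewrite (abreu_radial I_open I_pos phi_smooth g_radial)//; exact: WE.
  by case: (inv_hessian_radial I_open I_pos phi_smooth g_radial f_neq0 f'_neq0 Ix).
rewrite odeP; split=> -[l lE]; exists l => r Ir; apply/odeE => //; exact: lE.
Qed.
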